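(* Let $F\subset\mathbb G^d$ be the set $F=\bigcap_{s=1}^\infty F_s$ defined in the context, and let $\tau=\tau_F$ be the quasimeasure associated with $F$. Then $F$ is an $M$-set for the $d$-dimensional Walsh system with respect to convergence by rectangles, with respect to convergence by cubes, and with respect to repeated (iterated) convergence for every order of iterated summation. Moreover, the $d$-fold Walsh series $\sum_{\mathbf n\in\mathbb N_0^d}\widehat\tau_{\mathbf n}W_{\mathbf n}(\mathbf g)$ generating $\tau$ is a null-series realizing the $M$-set $F$ (for each of these types of convergence).
   Context: Fix an integer $d\ge 2$. $\mathbb G$ is the dyadic group: the set of sequences $g=(g_k)_{k\ge0}$, $g_k\in\{0,1\}$, with coordinatewise addition mod 2 (denoted $\oplus$) and the product topology; $\mathbb G^d$ is its $d$-th power with coordinatewise $\oplus$, and $\mu$ is the normalized Haar measure on $\mathbb G^d$. For $n\in\mathbb N_0$ write $n=\sum_k n_k2^k$, $n_k\in\{0,1\}$. For $k\in\mathbb N_0$ and $0\le m<2^k$ the dyadic interval of rank $k$ is $\Delta^{(k)}_m=\{g\in\mathbb G: g_t=m_{k-1-t},\ 0\le t<k\}$; for $\mathbf m=(m^1,\dots,m^d)\in\{0,\dots,2^k-1\}^d$ the dyadic cube of rank $k$ is $\Delta^{(k)}_{\mathbf m}=\Delta^{(k)}_{m^1}\times\dots\times\Delta^{(k)}_{m^d}$. Vectors are compared coordinatewise ($\mathbf a<\mathbf b$ iff $a^j<b^j$ for all $j$), $\mathbf 1=(1,\dots,1)$. Walsh functions: $W_n(g)=\prod_{k\ge0}(-1)^{g_kn_k}$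 and $W_{\mathbf n}(\mathbf g)=\prod_{l=1}^dW_{n^l}(g^l)$ for $\mathbf n\in\mathbb N_0^d$. For $\mathbf n,\mathbf m<2^k\mathbf 1$, $W_{\mathbf n}$ is constant on $\Delta^{(k)}_{\mathbf m}$; denote this value $W^{(k)}_{\mathbf n\mathbf m}$. Put $R_{k\mathbf 1}:=W_{2^k\mathbf 1}$. A $d$-fold Walsh series is $\sum_{\mathbf n\in\mathbb N_0^d}a_{\mathbf n}W_{\mathbf n}(\mathbf g)$, $a_{\mathbf n}\in\mathbb C$, with partial sums $S_{\mathbf N}(\mathbf g)=\sum_{\mathbf n<\mathbf N}a_{\mathbf n}W_{\mathbf n}(\mathbf g)$, $\mathbf N\in\mathbb N^d$. It converges by rectangles at $\mathbf g$ to $S$ if $S_{\mathbf N}(\mathbf g)\to S$ as $\min_jN^j\to\infty$; by cubes if $S_{N\mathbf 1}(\mathbf g)\to S$ as $N\to\infty$; repeatedly for a permutation $(j_1,\dots,j_d)$ of $(1,\dots,d)$ if $\sum_{n^{j_1}\in\mathbb N_0}\big(\sum_{n^{j_2}\in\mathbb N_0}\big(\cdots\big(\sum_{n^{j_d}\in\mathbb N_0}a_{\mathbf n}W_{\mathbf n}(\mathbf g)\big)\cdots\big)\big)=S$, each series converging. A set $A\subset\mathbb G^d$ is an $M$-set (for a given convergence type) if some series with not all coefficients zero converges to $0$ at every point of $\mathbb G^d\setminus A$; such a series is a null-series realizing $A$. A quasimeasure is a function $\tau$ on dyadic cubes with $\tau(\Delta^{(k)}_{\mathbf m})=\sum_{\boldsymbol\sigma\in\{0,1\}^d}\tau(\Delta^{(k+1)}_{2\mathbf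 m+\boldsymbol\sigma})$ for all $k,\mathbf m$. Its Fourier–Walsh coefficients are $\widehat\tau_{\mathbf n}=\sum_{\mathbf m<2^k\mathbf 1}W^{(k)}_{\mathbf n\mathbf m}\tau(\Delta^{(k)}_{\mathbf m})$ for any $k$ with $\mathbf n<2^k\mathbf 1$; the series $\sum\widehat\tau_{\mathbf n}W_{\mathbf n}$ is the series generating $\tau$ (equivalently, $\tau(\Delta^{(k)})=2^{-kd}S_{2^k\mathbf 1}(\mathbf g)$ for $\mathbf g\in\Delta^{(k)}$). For a nonempty closed $F\subset\mathbb G^d$, $\tau_F$ is the unique nonnegative quasimeasure with $\tau_F(\mathbb G^d)=1$, $\tau_F(\Delta)=0$ iff $\Delta\cap F=\emptyset$, and such that if $\Delta^{(k)}_{\mathbf m}\cap F\neq\emptyset$ and exactly $M$ of the $2^d$ cubes $\Delta^{(k+1)}_{2\mathbf m+\boldsymbol\sigma}$ meet $F$, then each of those has $\tau_F$-value $\tau_F(\Delta^{(k)}_{\mathbf m})/M$ (the others have value $0$). The set $F$: let $m_1=0$, $m_{s+1}=2(2m_s+1)$. For $s\in\mathbb N$ put $F_s=\bigcup_{\mathbf m<2^{m_s}\mathbf 1}\bigcup_{\mathbf m'<2^{m_s}\mathbf 1}\{\mathbf g\in\Delta^{(2m_s)}_{2^{m_s}\mathbf m+\mathbf m'}: R_{2m_s\mathbf 1}(\mathbf g)=W^{(m_s)}_{\mathbf m\mathbf m'}\}$, and $F=\bigcap_{s\ge1}F_s$. *)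

(* Defs.v *)
From HB Require Import structures.
From mathcomp Require Import all_boot all_order all_algebra.
From mathcomp Require Import boolp reals.
From mathcomp Require Import complex.

Set Implicit Arguments.
Unset Strict Implicit.
Unset Printing Implicit Defensive.

Import Order.TTheory GRing.Theory Num.Theory.
Local Open Scope ring_scope.
Local Open Scope complex_scope.

Definition G := nat -> bool.
Definition Gd (d : nat) := 'I_d -> G.
Definition natv (d : nat) := 'I_d -> nat.

Definition bit (n k : nat) : bool := odd (n %/ 2 ^ k).

(* Walsh function W_n(g) = prod_k (-1)^(g_k n_k); only k < n can have n_k = 1
   (since 2^k > n for k >= n), so the product is finite. *)
Definition walsh {T : pzRingType} (n : nat) (g : G) : T :=
  (-1) ^+ (\sum_(k < n) ((g k && bit n k) : nat))%N.

Definition walshd {T : pzRingType} (d : nat) (n : natv d) (g : Gd d) : T :=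
  \prod_(l < d) walsh (n l) (g l).

Definition in_cube (d k : nat) (m : natv d) (g : Gd d) : Prop :=
  forall (l : 'I_d) (t : nat), (t < k)%N -> g l t = bit (m l) (k - 1 - t).

Definition cube_pt (d k : nat) (m : natv d) : Gd d :=
  fun l t => if (t < k)%N then bit (m l) (k - 1 - t) else false.

(* W^(k)_{n m}: the value of W_n on Delta^(k)_m *)
Definition walsh_cube {T : pzRingType} (d k : nat) (n m : natv d) : T :=
  walshd n (cube_pt k m).

(* the sequence m_1 = 0, m_{s+1} = 2(2 m_s + 1); msq i = m_(i+1) *)
Fixpoint msq (i : nat) : nat :=
  match i with 0 => 0 | i'.+1 => 2 * (2 * msq i' + 1) end.

(* F_s with s = i+1 *)
Definition Fs {R : realType} (d i : nat) (g : Gd d) : Prop :=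
  let ms := msq i in
  exists m m' : natv d,
    (forall l, (m l < 2 ^ ms)%N) /\ (forall l, (m' l < 2 ^ ms)%N) /\
    in_cube (2 * ms) (fun l => 2 ^ ms * m l + m' l)%N g /\
    walshd (fun _ => 2 ^ (2 * ms))%N g = walsh_cube (T := R) ms m m'.

Definition Fset {R : realType} (d : nat) (g : Gd d) : Prop :=
  forall i, Fs (R := R) i g.

Definition meets (d k : nat) (m : natv d) (A : Gd d -> Prop) : Prop :=
  exists g, A g /\ in_cube k m g.

(* the quasimeasure tau_A (for A = F): tau(G^d) = 1 and the mass of a cube is
   split equally among those of its 2^d children that meet A. *)
Fixpoint tau_of {R : realType} (d : nat) (A : Gd d -> Prop) (k : nat)
  (m : natv d) : R :=
  match k with
  | 0 => 1
  | k'.+1 =>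
    if `[< meets k'.+1 m A >] then
      tau_of A k' (fun l => m l %/ 2)%N /
      ((\sum_(s : {ffun 'I_d -> bool})
          (`[< meets k'.+1 (fun l => 2 * (m l %/ 2) + s l)%N A >] : nat))%N)%:R
    else 0
  end.

Definition tauF {R : realType} (d : nat) (k : nat) (m : natv d) : R :=
  tau_of (Fset (R := R) (d := d)) k m.

(* Fourier-Walsh coefficients of a quasimeasure, computed at the rank
   k = max_l n^l (so that n < 2^k 1). *)
Definition quasi_coef {R : realType} (d : nat) (tau : nat -> natv d -> R)
  (n : natv d) : R :=
  let k := (\max_(l < d) n l)%N in
  \sum_(m : {ffun 'I_d -> 'I_(2 ^ k)})
    walsh_cube k n (fun l => nat_of_ord (m l)) * tau k (fun l => nat_of_ord (m l)).

Definition tauF_coef {R : realType} (d : nat) (n : natv d) : R[i] :=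
  (quasi_coef (tauF (R := R) (d := d)) n)%:C.

Definition psum {R : realType} (d : nat) (a : natv d -> R[i]) (N : natv d)
  (g : Gd d) : R[i] :=
  \sum_(n : {ffun 'I_d -> 'I_(\max_(l < d) N l)} | [forall l, (n l < N l)%N])
    a (fun l => nat_of_ord (n l)) * walshd (fun l => nat_of_ord (n l)) g.

Definition cvgC {R : realType} (u : nat -> R[i]) (S : R[i]) : Prop :=
  forall e : R, 0 < e -> exists K, forall N, (K <= N)%N -> `|u N - S| < e%:C.

Definition series_to {R : realType} (b : nat -> R[i]) (S : R[i]) : Prop :=
  cvgC (fun N => \sum_(k < N) b k) S.

Definition cvg_rect {R : realType} (d : nat) (a : natv d -> R[i]) (g : Gd d)
  (S : R[i]) : Prop :=
  forall e : R, 0 < e -> exists K, forall N : natv d,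
    (forall l, (0 < N l)%N /\ (K <= N l)%N) -> `|psum a N g - S| < e%:C.

Definition cvg_cube {R : realType} (d : nat) (a : natv d -> R[i]) (g : Gd d)
  (S : R[i]) : Prop :=
  cvgC (fun N => psum a (fun _ => N) g) S.

(* Iterated summation: the coordinates in js are summed, the head being the
   outermost sum; the other coordinates are fixed by n. Each series must
   converge. *)
Definition setc (d : nat) (n : natv d) (j : 'I_d) (x : nat) : natv d :=
  fun l => if l == j then x else n l.

Fixpoint iter_sum {R : realType} (d : nat) (js : seq 'I_d)
  (f : natv d -> R[i]) (n : natv d) (S : R[i]) : Prop :=
  match js with
  | [::] => S = f n
  | j :: js' => exists b : nat -> R[i],
      (forall x, iter_sum js' f (setc n j x) (b x)) /\ series_to b S
  end.

(* repeated convergence for the order js (a permutation of 'I_d) *)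
Definition cvg_rep {R : realType} (d : nat) (js : seq 'I_d)
  (a : natv d -> R[i]) (g : Gd d) (S : R[i]) : Prop :=
  iter_sum js (fun n => a n * walshd n g) (fun _ => 0%N) S.

Definition null_series {R : realType} (d : nat)
  (cv : (natv d -> R[i]) -> Gd d -> R[i] -> Prop)
  (A : Gd d -> Prop) (a : natv d -> R[i]) : Prop :=
  (exists n, a n != 0) /\ (forall g, ~ A g -> cv a g 0).

Definition Mset {R : realType} (d : nat)
  (cv : (natv d -> R[i]) -> Gd d -> R[i] -> Prop) (A : Gd d -> Prop) : Prop :=
  exists a, null_series cv A a.

(* Main.v *)
Require Import Defs.
From HB Require Import structures.
From mathcomp Require Import all_boot all_order all_algebra.
From mathcomp Require Import boolp reals.
From mathcomp Require Import complex.
From mathcomp Require Import zify ring lra.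

(** Membership in [F_s] is the condition [chi s g = 1] for the sign
    [chi s g = prod_l (-1) ^ (g^l_{2m} + sum_{t<m} g^l_{m-1-t} g^l_{m+t})], [m = m_s],
    so [tau_F] is the Riesz product [prod_s (1 + chi s)] and its series splits into
    the blocks [prod_{j<s} (1 + chi j) * chi s], whose frequencies all lie in
    [[2^{2m}, 2^{2m+1})^d].  The quadratic form is its own Fourier transform, with
    coefficients of size [2^{-md}], and the factor [prod_{j<s} (1 + chi j)] only sees
    the leading half of the bits of the frequency.  Outside [F] that factor vanishes
    near [g], so a rectangular partial sum of block [s] at [g] only receives
    contributions containing a bounded Dirichlet kernel, and it is
    [O(2^{s - m_s})].  A rectangular partial sum of the whole series is
    [prod_{j<s} (1 + chi j g)] plus one partial block.  Iterated sums reduce to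
    rectangular ones, because fixing one frequency leaves finitely many nonzero
    coefficients. *)

Set Implicit Arguments.
Unset Strict Implicit.
Unset Printing Implicit Defensive.

Import Order.TTheory GRing.Theory Num.Theory.
Local Open Scope ring_scope.
Local Open Scope complex_scope.

(** * Binary digits *)

Lemma bit_small n k : (n < 2 ^ k)%N -> bit n k = false.
Proof. by move=> h; rewrite /bit divn_small. Qed.

Lemma bit_high n k t : (n < 2 ^ k)%N -> (k <= t)%N -> bit n t = false.
Proof. by move=> h kt; apply: bit_small; apply: leq_trans h _; rewrite leq_exp2l. Qed.

Lemma bitMD m u v t : (v < 2 ^ m)%N ->
  bit (2 ^ m * u + v) t = if (t < m)%N then bit v t else bit u (t - m).
Proof.
move=> hv; rewrite /bit; case: ltnP => h.
  rewrite -{1}(subnK (ltnW h)) expnD -mulnA [(2 ^ t * u)%N]mulnC mulnA.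
  rewrite divnMDl ?expn_gt0 // oddD oddM oddX subn_eq0 leqNgt h /= ?andbF.
  by [].
rewrite -{1}(subnKC h) expnD divnMA mulnC divnMDl ?expn_gt0 //.
by rewrite (divn_small hv) addn0.
Qed.

Lemma bit_half (n t : nat) : bit (n %/ 2) t = bit n t.+1.
Proof. by rewrite /bit expnS divnMA. Qed.

(** Inverse of [bit] on words of [k] digits: it yields the indices whose digits are prescribed by a
    point of the group. *)
Fixpoint bitsum (k : nat) (x : nat -> bool) : nat :=
  if k is k'.+1 then 2 ^ k' * x k' + bitsum k' x else 0.

Lemma bitsum_lt k x : (bitsum k x < 2 ^ k)%N.
Proof. by elim: k => //= k IH; rewrite expnS; case: (x k); lia. Qed.

Lemma bit_bitsum k x t : bit (bitsum k x) t = (t < k)%N && x t.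
Proof.
elim: k => [|k IH] /=; first by rewrite /bit div0n.
rewrite bitMD ?bitsum_lt // IH ltnS; case: ltngtP => //= h.
  by rewrite (@bit_high _ 1) //; [case: (x k) | lia].
by rewrite h subnn /bit divn1; case: (x k).
Qed.

Lemma bitsum_bit k n : bitsum k (bit n) = (n %% 2 ^ k)%N.
Proof.
elim: k => [|k IH] /=; first by rewrite modn1.
rewrite IH /bit expnS -modn2.
rewrite modn_divl [RHS](divn_eq _ (2 ^ k)) modn_dvdm ?dvdn_mull //.
by rewrite mulnC.
Qed.

Lemma eq_bitsum k x y : (forall t, (t < k)%N -> x t = y t) -> bitsum k x = bitsum k y.
Proof.
elim: k => //= k IH h; rewrite h // IH // => t tk; apply: h.
exact: ltnW.
Qed.

Lemma bit_inj k n n' : (n < 2 ^ k)%N -> (n' < 2 ^ k)%N ->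
  (forall t, (t < k)%N -> bit n t = bit n' t) -> n = n'.
Proof.
move=> hn hn' /eq_bitsum; by rewrite !bitsum_bit !modn_small.
Qed.

(** * Walsh functions as products of signs *)

Section Sign.
Variable R : comNzRingType.

Definition sg (b : bool) : R := (-1) ^+ b.

Lemma sgD a b : sg (a (+) b) = sg a * sg b.
Proof. exact: signr_addb. Qed.

(** Digits of [n] beyond its length are zero, so the range of the product is free; frequencies of
    different size can then share one range. *)
Lemma walsh_prod K n (g : G) : (n < 2 ^ K)%N ->
  walsh n g = \prod_(k < K) sg (g k && bit n k).
Proof.
move=> hK; rewrite /walsh expr_sum.
have ext L M : (n < 2 ^ L)%N -> (L <= M)%N ->
    \prod_(k < L) sg (g k && bit n k) = \prod_(k < M) sg (g k && bit n k).
  move=> hL hLM; rewrite -!(big_mkord xpredT (fun k => sg (g k && bit n k))).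
  rewrite (big_cat_nat (leq0n L) hLM) /= [X in _ = _ * X]big1_seq ?mulr1 //.
  move=> k /andP[_]; rewrite mem_index_iota => /andP[hk _].
  by rewrite (bit_high hL hk) andbF.
(* The range [n + K] dominates both ranges, which need not be ordered. *)
transitivity (\prod_(k < n + K) sg (g k && bit n k)).
  by apply: ext; rewrite ?leq_addr // ltn_expl.
by apply/esym/ext; rewrite ?leq_addl.
Qed.
End Sign.

(** * Walsh-Dirichlet kernels, the quadratic phase and orthogonality *)

Section Dirichlet.
Variable R : realFieldType.
Local Notation sg := (sg R).

Lemma sg_norm b : `|sg b| = 1.
Proof. exact: normr_sign. Qed.

Lemma prod_norm1 (I : Type) (r : seq I) (F : I -> R) :
  (forall i, `|F i| = 1) -> `|\prod_(i <- r) F i| = 1.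
Proof. by move=> h; rewrite normr_prod big1. Qed.

(** Walsh-Dirichlet kernel with at most [2 ^ m] terms. The cutoff [V] is a filter that may exceed
    [2 ^ m], so that splitting off the top digit of [v] simply replaces [V] by the truncated
    difference [V - 2 ^ m]. *)
Definition dirichlet (m V : nat) (x : nat -> bool) : R :=
  \sum_(0 <= v < 2 ^ m | (v < V)%N) \prod_(t < m) sg (bit v t && x t).

Lemma dirichletS m V x :
  dirichlet m.+1 V x = dirichlet m V x + sg (x m) * dirichlet m (V - 2 ^ m) x.
Proof.
rewrite /dirichlet expnS mul2n -addnn (big_cat_nat (leq0n (2 ^ m)%N)) ?leq_addr //=.
congr (_ + _).
  rewrite big_nat_cond [RHS]big_nat_cond; apply: eq_bigr => v /andP[/andP[_ hv] _].
  by rewrite big_ord_recr /= (bit_small hv) mulr1.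
rewrite -{1}[(2 ^ m)%N]add0n big_addn addnK mulr_sumr big_nat_cond [RHS]big_nat_cond.
apply: eq_big => [v|v /andP[/andP[_ hv] _]].
  by rewrite ltn_subRL addnC.
have E t : bit (v + 2 ^ m) t = if (t < m)%N then bit v t else bit 1 (t - m).
  by rewrite -bitMD // muln1 addnC.
rewrite big_ord_recr /= mulrC E ltnn subnn; congr (_ * _).
by apply: eq_bigr => t _; rewrite E ltn_ord.
Qed.

Lemma dirichlet0 m x : dirichlet m 0 x = 0.
Proof. by rewrite /dirichlet big1. Qed.

Lemma dirichlet_full m V x : (2 ^ m <= V)%N ->
  dirichlet m V x = \prod_(t < m) (1 + sg (x t)).
Proof.
elim: m V => [|m IH] V hV.
  by rewrite /dirichlet big_mkcond big_nat1 hV !big_ord0.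
rewrite dirichletS !IH ?big_ord_recr /=; first by ring.
  by move: hV; rewrite expnS; lia.
by move: hV; rewrite expnS; lia.
Qed.

Lemma dirichlet_norm_le m V x : `|dirichlet m V x| <= 2 ^+ m.
Proof.
elim: m V => [|m IH] V.
  by rewrite /dirichlet big_mkcond big_nat1 big_ord0; case: ifP; rewrite ?normr0 ?normr1.
rewrite dirichletS exprS; apply: le_trans (ler_normD _ _) _.
by rewrite normrM sg_norm mul1r; have := IH V; have := IH (V - 2 ^ m)%N; lra.
Qed.

Lemma dirichlet_full_eq0 m V (x : nat -> bool) t : (2 ^ m <= V)%N -> (t < m)%N -> x t ->
  dirichlet m V x = 0.
Proof.
move=> hV ht hx; rewrite dirichlet_full // (bigD1 (Ordinal ht)) //= hx.
by rewrite /sg expr1 subrr mul0r.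
Qed.

(** At each level above [k] only one half of the kernel survives: either the lower half is complete
    and vanishes because of position [t], or the cutoff leaves the upper half empty. Hence the
    trivial bound at level [k] never doubles. *)
Lemma dirichlet_norm_le_low m k V (x : nat -> bool) t : (k <= m)%N -> (t < k)%N -> x t ->
  `|dirichlet m V x| <= 2 ^+ k.
Proof.
move=> km tk xt; rewrite -(subnKC km); elim: (m - k)%N V => [|p IH] V.
  by rewrite addn0 dirichlet_norm_le.
rewrite addnS dirichletS; case: (leqP (2 ^ (k + p)) V) => hV.
  rewrite (@dirichlet_full_eq0 _ _ _ t) ?add0r ?normrM ?sg_norm ?mul1r //.
  by rewrite (leq_trans tk) ?leq_addr.
have -> : (V - 2 ^ (k + p))%N = 0%N by lia.
by rewrite dirichlet0 mulr0 addr0.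
Qed.

Lemma sum_bits_char m (x : nat -> bool) :
  \sum_(v < 2 ^ m) \prod_(t < m) sg (bit v t && x t) =
  \prod_(t < m) (1 + sg (x t)).
Proof.
rewrite -(@dirichlet_full m (2 ^ m) x) // /dirichlet big_nat_cond.
rewrite -(big_mkord xpredT (fun v => \prod_(t < m) sg (bit v t && x t))).
rewrite big_nat_cond; apply: eq_bigl => v.
by rewrite /= andbT; case: (v < 2 ^ m)%N; rewrite ?andbT ?andbF.
Qed.

Lemma prod_1Dsg m (x : nat -> bool) :
  \prod_(t < m) (1 + sg (x t)) = 2 ^+ m * [forall t : 'I_m, ~~ x t]%:R.
Proof.
case: forallP => h.
  rewrite mulr1 (eq_bigr (fun=> 2)) ?prodr_const ?card_ord // => t _.
  by rewrite (negbTE (h t)).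
have [t ht] : exists t : 'I_m, x t.
  apply/existsP; apply: contra_notT h => /existsPn h t; exact: h.
by rewrite (bigD1 t) //= ht /sg expr1 subrr mul0r mulr0.
Qed.

(** On a cube of rank [2 * m] this is the one-dimensional factor of the value that defines [Fs];
    digits are paired symmetrically about the middle because cube indices list digits in reverse
    order. *)
Definition quad m (x : nat -> bool) : R :=
  \prod_(t < m) sg (x (m - 1 - t)%N && x (m + t)%N).

Lemma quad_norm m x : `|quad m x| = 1.
Proof. by apply: prod_norm1 => t; rewrite sg_norm. Qed.

Lemma eq_quad m x y : (forall t, (t < 2 * m)%N -> x t = y t) ->
  quad m x = quad m y.
Proof.
move=> h; apply: eq_bigr => t _; have := ltn_ord t => ht.
by rewrite !h //; lia.
Qed.

(** The product of two characters is the character of the digitwise sum of [n] and [n'], which sums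
    to 0 unless it is trivial. The points follow the reversed digit order of [cube_pt]. *)
Lemma walsh_orth k n n' : (n < 2 ^ k)%N -> (n' < 2 ^ k)%N ->
  \sum_(m < 2 ^ k) (walsh n (fun t => if (t < k)%N then bit m (k - 1 - t) else false)
   * walsh n' (fun t => if (t < k)%N then bit m (k - 1 - t) else false))
   = (2 ^+ k * (n == n')%:R : R).
Proof.
move=> hn hn'.
pose x t := bit n (k - 1 - t) (+) bit n' (k - 1 - t).
transitivity (\prod_(t < k) (1 + sg (x t))).
  rewrite -sum_bits_char; apply: eq_bigr => m _.
  rewrite !(@walsh_prod _ k) // -big_split /= [RHS](reindex_inj rev_ord_inj) /=.
  apply: eq_bigr => t _; rewrite ltn_ord /x.
  have -> : (k - 1 - (k - t.+1) = t)%N by have := ltn_ord t; lia.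
  have -> : (k - t.+1 = k - 1 - t)%N by lia.
  by rewrite -sgD; case: bit => //=; case: bit; case: bit.
rewrite prod_1Dsg; congr (_ * _%:R); congr nat_of_bool.
apply/forallP/eqP => [h|h t]; last by rewrite /x h addbb.
apply: (bit_inj hn hn') => t tk.
have ht : (k - 1 - t < k)%N by lia.
have := h (Ordinal ht); rewrite /x /=.
have -> : (k - 1 - (k - 1 - t) = t)%N by lia.
by case: bit; case: bit.
Qed.
End Dirichlet.

(** * Sums of the quadratic phase over frequencies with a given upper half *)

Lemma sum_div_fibre (R : nmodType) (F : nat -> R) c u N M : (0 < c)%N -> (N <= M)%N ->
  \sum_(n < M | (n < N)%N && (n %/ c == u)%N) F n =
  \sum_(0 <= v < c | (v < N - c * u)%N) F (c * u + v)%N.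
Proof.
move=> c0 NM; rewrite -(big_mkord (fun n => (n < N)%N && (n %/ c == u)%N) F).
(* The range is enlarged to contain the whole fibre over [u], even where it exceeds [M]; the filter
   [n < N] discards the added terms. *)
transitivity (\sum_(0 <= n < M + (c * u + c) | (n < N)%N && (n %/ c == u)%N) F n).
  rewrite [RHS](big_cat_nat (leq0n M)) ?leq_addr //= [X in _ = _ + X]big1_seq ?addr0 //.
  move=> n /andP[/andP[h _]]; rewrite mem_index_iota; lia.
rewrite (big_cat_nat (leq0n (c * u))) /=; last by lia.
rewrite big1_seq ?add0r; last first.
  move=> n /andP[/andP[_ /eqP h]]; rewrite mem_index_iota => /andP[_ hn].
  by move: hn; rewrite -h mulnC ltnNge leq_trunc_div.
rewrite (big_cat_nat (leq_addr c (c * u))) /=; last by lia.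
rewrite [X in _ + X]big1_seq ?addr0; last first.
  move=> n /andP[/andP[_ /eqP h]]; rewrite mem_index_iota => /andP[hn _].
  move: hn; rewrite -h -mulnSr mulnC leqNgt; case/negP.
  exact: ltn_ceil.
rewrite -{1}[(c * u)%N]add0n big_addn addnC addnK big_nat_cond [RHS]big_nat_cond.
apply: eq_big => [v|v _]; last by rewrite addnC.
case: (ltnP v c) => //= hv; rewrite addnC mulnC divnMDl // (divn_small hv).
by rewrite addn0 eqxx andbT ltn_subRL mulnC.
Qed.

Section Block.
Variable R : realFieldType.
Local Notation sg := (sg R).
Local Notation quad := (quad R).

(** [M] only provides a finite index type that all coordinates can share; [N] is the actual cutoff.
    The last condition keeps [n] in the dyadic block from [2 ^ (2 * m)] to twice that value. *)
Definition fibre_sum m M N (x : G) u : R :=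
  \sum_(n < M) ([&& (n < N)%N, (n %/ 2 ^ m == u)%N & (n %/ 2 ^ (2 * m) == 1)%N]%:R *
     (quad m (bit n) * walsh n x)).

(* On the fibre [n = 2 ^ m * u + v] the phase of [quad m (bit n) * walsh n x] is
   linear in [v], which leaves a Dirichlet kernel. *)
Lemma fibre_sumE m M N x u : (N <= M)%N ->
  fibre_sum m M N x u = (u %/ 2 ^ m == 1)%N%:R *
    (sg (x (2 * m)%N) * \prod_(t < m) sg (bit u t && x (m + t)%N)) *
    dirichlet R m (N - 2 ^ m * u) (fun t => x t (+) bit u (m - 1 - t)).
Proof.
move=> NM; rewrite /fibre_sum.
transitivity (\sum_(n < M | (n < N)%N && (n %/ 2 ^ m == u)%N)
   ((n %/ 2 ^ (2 * m) == 1)%N%:R * (quad m (bit n) * walsh n x))).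
  rewrite [RHS]big_mkcond; apply: eq_bigr => n _.
  by case: (n < N)%N; case: (_ == u) => //=; rewrite ?mul0r.
rewrite (sum_div_fibre (fun n => (n %/ 2 ^ (2 * m) == 1)%N%:R *
   (quad m (bit n) * walsh n x))) ?expn_gt0 //.
rewrite /dirichlet mulr_sumr big_nat_cond [RHS]big_nat_cond.
apply: eq_bigr => v /andP[/andP[_ hv] _].
have -> : ((2 ^ m * u + v) %/ 2 ^ (2 * m) = u %/ 2 ^ m)%N.
  by rewrite mul2n -addnn expnD divnMA mulnC divnMDl ?expn_gt0 // (divn_small hv) addn0.
case: eqP => hu; last by rewrite !mul0r.
rewrite !mul1r (@walsh_prod _ (m + m + 1)%N); last first.
  have hu2 : (u < 2 ^ m * 2)%N by rewrite mulnC -ltn_divLR ?expn_gt0 // hu.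
  rewrite !expnD -mulnA; apply: (@leq_trans (2 ^ m * u.+1)); first by rewrite mulnS; lia.
  by rewrite leq_mul2l hu2 orbT.
(* Positions below [m] carry the digits of [v], the next [m] those of [u], and position [2 * m] the
   leading digit of [u], which is 1. *)
rewrite big_split_ord big_split_ord /= big_ord1 /= !addn0.
rewrite /quad (reindex_inj rev_ord_inj) /=.
rewrite [bit _ (m + m)]bitMD // ltnNge leq_addr /= addnK.
have -> : bit u m by rewrite /bit hu.
rewrite andbT.
rewrite addnn -mul2n.
rewrite [LHS]mulrA [LHS]mulrC -[RHS]mulrA; congr (_ * _).
rewrite -!big_split /=; apply: eq_bigr => t _.
have ht := ltn_ord t.
have -> : (m - 1 - (m - t.+1) = t)%N by lia.
rewrite !bitMD // ht !ltnNge !leq_addr /=.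
have -> : (m + (m - t.+1) - m = m - 1 - t)%N by lia.
have -> : (m + t - m = t)%N by lia.
by case: (bit v t); case: (x t); case: (bit u t); case: (x (m + t)%N); case: (bit u _);
  rewrite /= /sg; ring.
Qed.
End Block.

Lemma divn_between N c u : (c * u <= N)%N -> (N < c * u + c)%N -> (N %/ c = u)%N.
Proof.
move=> h1 h2; rewrite -(subnKC h1) mulnC divnMDl; last by lia.
by rewrite divn_small ?addn0 // mulnC; lia.
Qed.

(** * Self-duality of the quadratic phase and bounds for cut fibres *)

Section FibreSums.
Variable R : realFieldType.
Local Notation sg := (sg R).
Local Notation quad := (quad R).
Local Notation fibre_sum := (fibre_sum R).

(* With [u = n %/ 2 ^ m], this is the point where the Fourier coefficient of index
   [n] of the quadratic phase [quad m] is concentrated. *)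
Definition revtop m u : G := fun t => bit u (m - 1 - t).

(** Inverse of [revtop]: a leading 1 followed by the first [m] digits of [x] reversed. It is the
    only [u] whose complete fibre contributes at [x]. *)
Definition top_index m (x : G) : nat := (2 ^ m + bitsum m (fun t => x (m - 1 - t)%N))%N.

Lemma bit_top_index m x t : (t < m)%N -> bit (top_index m x) t = x (m - 1 - t)%N.
Proof.
by move=> h; rewrite /top_index -[X in (X + _)%N]muln1 bitMD ?bitsum_lt // bit_bitsum h.
Qed.

Lemma revtop_top_index m x t : (t < m)%N -> revtop m (top_index m x) t = x t.
Proof.
move=> h; rewrite /revtop bit_top_index; last by lia.
by congr x; lia.
Qed.

Lemma top_index_div m x : (top_index m x %/ 2 ^ m = 1)%N.
Proof.
rewrite /top_index -[X in (X + _)%N]mul1n divnMDl ?expn_gt0 //.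
by rewrite divn_small ?bitsum_lt.
Qed.

Lemma eq_top_index m x u :
  (u == top_index m x) = (u %/ 2 ^ m == 1)%N && [forall t : 'I_m, ~~ (x t (+) revtop m u t)].
Proof.
apply/eqP/andP => [->|[/eqP hu /forallP h]].
  rewrite top_index_div; split => //; apply/forallP => t.
  by rewrite revtop_top_index // addbb.
rewrite (divn_eq u (2 ^ m)) hu /top_index mul1n; congr (_ + _)%N.
rewrite -bitsum_bit; apply: eq_bitsum => t tm.
have ht : (m - 1 - t < m)%N by lia.
have := h (Ordinal ht); rewrite /revtop /=.
have -> : (m - 1 - (m - 1 - t) = t)%N by lia.
by case: bit; case: (x _).
Qed.

(** A complete Dirichlet kernel is [2 ^ m] times the indicator that [u] matches [x]; where they
    match, the remaining linear phase in [u] turns back into [quad m x]. This is the self-duality of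
    the quadratic phase. *)
Lemma fibre_sum_full m M N x u : (N <= M)%N -> (2 ^ m * u + 2 ^ m <= N)%N ->
  fibre_sum m M N x u = 2 ^+ m * (u == top_index m x)%:R * (sg (x (2 * m)%N) * quad m x).
Proof.
move=> NM hN; rewrite fibre_sumE // dirichlet_full; last by lia.
rewrite (prod_1Dsg R m (fun t => x t (+) bit u (m - 1 - t)%N)).
rewrite eq_top_index /revtop; case: eqP => hu; last by rewrite !(mul0r, mulr0).
case: forallP => h; last by rewrite !(mul0r, mulr0).
rewrite /= !mul1r !mulr1 mulrC; congr (_ * (_ * _)).
apply: eq_bigr => t _; congr sg; congr andb.
have ht : (m - 1 - t < m)%N by have := ltn_ord t; lia.
have := h (Ordinal ht) => /=.
have -> : (m - 1 - (m - 1 - t) = t)%N by have := ltn_ord t; lia.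
by case: bit; case: (x _).
Qed.

Lemma fibre_sum_le_dirichlet m M N x u : (N <= M)%N ->
  `|fibre_sum m M N x u| <=
  `|dirichlet R m (N - 2 ^ m * u) (fun t => x t (+) bit u (m - 1 - t))|.
Proof.
move=> NM; rewrite fibre_sumE // !normrM sg_norm mul1r prod_norm1; last first.
  by move=> t; rewrite sg_norm.
by case: eqP => _; rewrite ?normr0 ?mul0r // normr1 !mul1r.
Qed.

(** A fibre lies below [N], lies above it, or is cut by it. The first kind contributes only at
    [top_index], the second not at all, and the only cut fibre is that of [N %/ 2 ^ m]. *)
Lemma fibre_sum_norm_le m M N x u : (N <= M)%N ->
  `|fibre_sum m M N x u| <= 2 ^+ m * ((u == top_index m x) + (u == N %/ 2 ^ m)%N)%:R.
Proof.
move=> NM; case: (leqP (2 ^ m * u + 2 ^ m) N) => h1.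
  rewrite fibre_sum_full // !normrM sg_norm quad_norm !mulr1 normrX ger0_norm //.
  rewrite ler_pM2l ?exprn_gt0 // normr_nat ler_nat; lia.
case: (leqP N (2 ^ m * u)) => h2.
  apply: le_trans (fibre_sum_le_dirichlet m x u NM) _.
  have -> : (N - 2 ^ m * u = 0)%N by lia.
  by rewrite dirichlet0 normr0 mulr_ge0 ?exprn_ge0.
rewrite (@divn_between _ _ u) ?(ltnW h2) // eqxx.
apply: le_trans (fibre_sum_le_dirichlet m x u NM) _.
apply: le_trans (dirichlet_norm_le _ _ _ _) _.
rewrite ler_peMr ?exprn_ge0 // ler1n; lia.
Qed.

(** A mismatch at position [t] kills complete fibres and bounds the kernel of the cut one. The
    factor counting two values of [u] is kept so that the later sum over [u] stays bounded. *)
Lemma fibre_sum_norm_le_low m k M N x u t : (N <= M)%N ->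
  (k <= m)%N -> (t < k)%N -> x t != revtop m u t ->
  `|fibre_sum m M N x u| <= 2 ^+ k * ((u == top_index m x) + (u == N %/ 2 ^ m)%N)%:R.
Proof.
move=> NM km tk hx.
have hb : x t (+) bit u (m - 1 - t) by move: hx; rewrite /revtop; case: bit; case: (x _).
apply: le_trans (fibre_sum_le_dirichlet m x u NM) _.
case: (leqP (2 ^ m * u + 2 ^ m) N) => h1.
  rewrite (@dirichlet_full_eq0 _ _ _ _ t) //; [|lia|exact: leq_trans tk km].
  by rewrite normr0 mulr_ge0 ?exprn_ge0.
case: (leqP N (2 ^ m * u)) => h2.
  have -> : (N - 2 ^ m * u = 0)%N by lia.
  by rewrite dirichlet0 normr0 mulr_ge0 ?exprn_ge0.
rewrite (@divn_between _ _ u) ?(ltnW h2) // eqxx.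
apply: le_trans (@dirichlet_norm_le_low _ m k _ _ t km tk hb) _.
rewrite ler_peMr ?exprn_ge0 // ler1n; lia.
Qed.
End FibreSums.

(** * Lacunary ranks, Riesz products and their Walsh blocks *)

Lemma msq_lt i j : (j < i)%N -> (2 * (2 * msq j + 1) <= msq i)%N.
Proof.
elim: i => // i IH; rewrite ltnS leq_eqVlt => /orP[/eqP -> //|/IH] /=.
by lia.
Qed.

(** Turns the ratio [2 ^ i / 2 ^ msq i] of the block bound into at most [2 ^ - i]. *)
Lemma leq_msq i : (2 * i <= msq i)%N.
Proof. by elim: i => //= i IH; lia. Qed.

Section Riesz.
Variables (R : realFieldType) (d : nat).
Implicit Types (g : Gd d) (n : natv d).
Local Notation sg := (sg R).
Local Notation quad := (quad R).
Local Notation fibre_sum := (fibre_sum R).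

Definition chi i g : R := \prod_l (sg (g l (2 * msq i)%N) * quad (msq i) (g l)).

Definition riesz L g : R := \prod_(i < L) (1 + chi i g).

Lemma eq_chi i g g' : (forall l t, (t <= 2 * msq i)%N -> g l t = g' l t) ->
  chi i g = chi i g'.
Proof.
move=> h; apply: eq_bigr => l _; rewrite h //; congr (_ * _).
by apply: eq_quad => t ht; apply: h; lia.
Qed.

Lemma chi_norm i g : `|chi i g| = 1.
Proof. by apply: prod_norm1 => l; rewrite normrM sg_norm quad_norm mulr1. Qed.

Lemma chi_cases i g : chi i g = 1 \/ chi i g = -1.
Proof.
have := chi_norm i g; case: (ler0P (chi i g)) => _ h; last by left.
by right; rewrite -h opprK.
Qed.

Lemma eq_riesz L g g' :
  (forall l t i, (i < L)%N -> (t <= 2 * msq i)%N -> g l t = g' l t) ->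
  riesz L g = riesz L g'.
Proof.
move=> h; apply: eq_bigr => i _; congr (_ + _).
by apply: eq_chi => l t; apply: h.
Qed.

(** By the growth of [msq], all constraints before the [i]-th read only positions below [msq i],
    which are the positions that the upper half of a frequency determines through [revtop]. *)
Lemma eq_riesz_msq i g g' : (forall l t, (t < msq i)%N -> g l t = g' l t) ->
  riesz i g = riesz i g'.
Proof.
by move=> h; apply: eq_riesz => l t j ji ht; apply: h; have := msq_lt ji; lia.
Qed.

Lemma riesz_ge0 L g : 0 <= riesz L g.
Proof. by apply: prodr_ge0 => i _; case: (chi_cases i g) => ->; lra. Qed.

Lemma riesz_le L g : riesz L g <= 2 ^+ L.
Proof.
rewrite -[X in _ ^+ X]card_ord -prodr_const; apply: ler_prod => i _.
by case: (chi_cases i g) => ->; apply/andP; split; lra.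
Qed.

Lemma riesz_eq0 L g j : (j < L)%N -> chi j g = -1 -> riesz L g = 0.
Proof.
by move=> jL h; rewrite /riesz (bigD1 (Ordinal jL)) //= h subrr mul0r.
Qed.

Lemma rieszS L g : riesz L.+1 g = riesz L g * (1 + chi L g).
Proof. by rewrite /riesz big_ord_recr. Qed.

(** Telescoping: consecutive Riesz products differ by [riesz i g * chi i g]. *)
Lemma riesz_sum L g : riesz L g = 1 + \sum_(i < L) riesz i g * chi i g.
Proof.
elim: L => [|L IH]; first by rewrite /riesz !big_ord0 addr0.
by rewrite rieszS big_ord_recr /= addrA -IH mulrDr mulr1.
Qed.

(** Walsh coefficients of [riesz i * chi i]. The phase is self-dual and [riesz i] sees only the
    first [msq i] digits, so multiplying by it amounts to evaluating it at the dual point of the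
    frequency. *)
Definition block_coef i n : R :=
  [forall l, n l %/ 2 ^ (2 * msq i) == 1]%N%:R *
  riesz i (fun l => revtop (msq i) (n l %/ 2 ^ msq i)) *
  \prod_l (2 ^- msq i * quad (msq i) (bit (n l))).

Definition block_sum i M (N : natv d) g : R :=
  \sum_(n : {ffun 'I_d -> 'I_M} | [forall l, (n l < N l)%N])
    block_coef i (fun l => nat_of_ord (n l)) * walshd (fun l => nat_of_ord (n l)) g.

(** Frequencies are grouped by their vector [u] of upper halves: the Riesz factor depends on [u]
    alone, and what remains factors over the coordinates. *)
Lemma block_sumE i M N g :
  block_sum i M N g =
  \sum_(u : {ffun 'I_d -> 'I_M}) riesz i (fun l => revtop (msq i) (u l)) *
    \prod_l (2 ^- msq i * fibre_sum (msq i) M (N l) (g l) (u l)).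
Proof.
set m := msq i.
pose T (n : nat) (x : G) : R := 2 ^- m * (quad m (bit n) * walsh n x).
pose ok l (n u : nat) := [&& (n < N l)%N, (n %/ 2 ^ m == u)%N & (n %/ 2 ^ (2 * m) == 1)%N].
transitivity (\sum_(u : {ffun 'I_d -> 'I_M}) \sum_(n : {ffun 'I_d -> 'I_M})
   riesz i (fun l => revtop m (u l)) * \prod_l ((ok l (n l) (u l))%:R * T (n l) (g l))).
  rewrite exchange_big /= /block_sum big_mkcond; apply: eq_bigr => n _.
  have hM l : (n l %/ 2 ^ m < M)%N by apply: leq_ltn_trans (leq_div _ _) (ltn_ord _).
  (* For a given frequency, the vector of its quotients is the only [u] that contributes. *)
  pose u0 : {ffun 'I_d -> 'I_M} := [ffun l => Ordinal (hM l)].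
  rewrite (bigD1 u0) //= [X in _ + X]big1 ?addr0; last first.
    move=> u hu; have [l hl] : exists l, u l != u0 l.
      apply/existsP; apply: contra_neqT hu => /existsPn h; apply/ffunP => l.
      by have := h l; rewrite negbK => /eqP.
    rewrite (bigD1 l) //=.
    have -> : ok l (n l) (u l) = false.
      apply/negbTE; apply: contraNN hl => /and3P[_ /eqP h _]; apply/eqP.
      by apply: val_inj; rewrite /= ffunE /= h.
    by rewrite !(mul0r, mulr0).
  rewrite big_split /= /block_coef -/m.
  rewrite -natr_prod.
  have [/forallP hN|/forallPn[l hl]] := boolP [forall l, (n l < N l)%N]; last first.
    by rewrite (bigD1 l) //= /ok (negbTE hl) /= mul0n mul0r mulr0.
  have [/forallP h1|/forallPn[l hl]] := boolP [forall l, n l %/ 2 ^ (2 * m) == 1]%N; last first.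
    by rewrite !mul0r (bigD1 l) //= /ok (negbTE hl) !andbF mul0n !(mul0r, mulr0).
  have -> : (\prod_(l < d) ok l (n l) (u0 l) = 1)%N.
    by apply: big1 => l _; rewrite /ok hN h1 ffunE /= eqxx.
  rewrite !mul1r.
  rewrite -mulrA /walshd -big_split /=; congr (_ * _).
    by congr riesz; apply/funext => l; rewrite ffunE.
  by apply: eq_bigr => l _; rewrite /T mulrA.
apply: eq_bigr => u _; rewrite -mulr_sumr; congr (_ * _).
rewrite -(bigA_distr_bigA (fun l (n : 'I_M) => (ok l n (u l))%:R * T n (g l))).
apply: eq_bigr => l _; rewrite /fibre_sum mulr_sumr; apply: eq_bigr => n _.
by rewrite /ok /T mulrCA.
Qed.

(** Only the vector of the [top_index m (g l)] survives, and there [revtop] restores the digits of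
    [g] that [riesz i] reads. *)
Lemma block_sum_full i M N g : (forall l, N l <= M)%N ->
  (forall l, 2 ^ (2 * msq i).+1 <= N l)%N ->
  block_sum i M N g = riesz i g * chi i g.
Proof.
move=> NM hN; rewrite block_sumE; set m := msq i.
have hs l (u : 'I_M) : fibre_sum m M (N l) (g l) u =
    2 ^+ m * (u == top_index m (g l) :> nat)%:R * (sg (g l (2 * m)%N) * quad m (g l)).
  (* Below [2 ^ m.+1] the fibre of [u] ends no later than [2 ^ (2 * m).+1], hence is complete;
     larger [u] lie outside the block. *)
  case: (ltnP u (2 ^ m.+1)) => hu.
    apply: fibre_sum_full => //; apply: leq_trans (hN l).
    rewrite -/m mul2n -addnn -addnS expnD -mulnSr leq_mul2l; apply/orP; right; exact: hu.
  have hu1 : (u %/ 2 ^ m == 1)%N = false.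
    apply/negbTE; rewrite neq_ltn; apply/orP; right.
    by rewrite leq_divRL ?expn_gt0 // -expnS.
  by rewrite fibre_sumE // eq_top_index hu1 /= !(mul0r, mulr0).
have hM l : (top_index m (g l) < M)%N.
  apply: leq_trans (NM l); apply: leq_trans (hN l).
  rewrite /top_index; apply: (@leq_trans (2 ^ m.+1)); last by rewrite leq_exp2l // -/m; lia.
  by rewrite expnS; have := bitsum_lt m (fun t => g l (m - 1 - t)%N); lia.
pose u0 : {ffun 'I_d -> 'I_M} := [ffun l => Ordinal (hM l)].
rewrite (bigD1 u0) //= [X in _ + X]big1 ?addr0; last first.
  move=> u hu; have [l hl] : exists l, u l != u0 l.
    apply/existsP; apply: contra_neqT hu => /existsPn h; apply/ffunP => l.
    by have := h l; rewrite negbK => /eqP.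
  rewrite (bigD1 l) //= hs.
  have -> : (u l == top_index m (g l) :> nat) = false.
    by apply: contraNF hl => /eqP h; apply/eqP/val_inj; rewrite ffunE.
  by rewrite !(mul0r, mulr0).
congr (_ * _).
  apply: eq_riesz_msq => l t ht; rewrite ffunE /= revtop_top_index //.
apply: eq_bigr => l _; rewrite hs ffunE /= eqxx mulr1 mulKf //.
by rewrite expf_neq0 // pnatr_eq0.
Qed.

(* The Riesz product vanishes when every [revtop] agrees with [g] up to the first
   violated constraint; otherwise one of the [d] Dirichlet kernels is evaluated
   at a point that is not close to zero, hence is bounded independently of [i]. *)
Lemma block_sum_norm_le i j M N g : (forall l, N l <= M)%N -> (j < i)%N ->
  chi j g = -1 ->
  `|block_sum i M N g| <= 2 ^+ i * (2 ^+ (2 * msq j).+1 / 2 ^+ msq i) * 2 ^+ d.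
Proof.
move=> NM ji hj; rewrite block_sumE; set m := msq i; set k := (2 * msq j).+1.
have km : (k <= m)%N by rewrite /k /m; have := msq_lt ji; lia.
(* At most two values of [u] count in each coordinate, which produces the factor [2 ^+ d] after
   summation. *)
pose e l (u : nat) : R := ((u == top_index m (g l)) + (u == N l %/ 2 ^ m)%N)%:R.
have e0 l u : 0 <= e l u by [].
apply: (@le_trans _ _ (\sum_(u : {ffun 'I_d -> 'I_M})
   2 ^+ i * (2 ^+ k / 2 ^+ m) * \prod_l e l (u l))).
  apply: le_trans (ler_norm_sum _ _ _) _; apply: ler_sum => u _.
  case: (boolP [forall l, forall t : 'I_k, g l t == revtop m (u l) t]) => h.
    rewrite (@riesz_eq0 _ _ j) // ?mul0r ?normr0.
      by rewrite !mulr_ge0 ?invr_ge0 ?exprn_ge0 // prodr_ge0.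
    rewrite -hj; apply: eq_chi => l t ht; apply/esym/eqP.
    have ht' : (t < k)%N by [].
    by move/forallP: h => /(_ l)/forallP/(_ (Ordinal ht')).
  rewrite normrM -mulrA ler_pM //.
    by rewrite ger0_norm ?riesz_ge0 ?riesz_le.
  case/forallPn: h => l0 /forallPn[t ht].
  rewrite normr_prod (bigD1 l0) //= [X in _ <= _ * X](bigD1 l0) //= mulrA.
  have hm l : `|2 ^- m * fibre_sum m M (N l) (g l) (u l)| <= e l (u l).
    rewrite normrM ger0_norm ?invr_ge0 ?exprn_ge0 // ler_pdivrMl ?exprn_gt0 //.
    exact: fibre_sum_norm_le.
  apply: ler_pM => //; first by apply: prodr_ge0.
    rewrite normrM ger0_norm ?invr_ge0 ?exprn_ge0 // ler_pdivrMl ?exprn_gt0 //.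
    rewrite mulrA mulrCA mulfV ?expf_neq0 ?pnatr_eq0 // mulr1.
    exact: (@fibre_sum_norm_le_low _ _ _ _ _ _ _ t).
  by apply: ler_prod => l _; rewrite normr_ge0 hm.
rewrite -mulr_sumr ler_wpM2l ?mulr_ge0 ?invr_ge0 ?exprn_ge0 //.
rewrite -(bigA_distr_bigA (fun l (n : 'I_M) => e l n)).
rewrite -[X in _ ^+ X]card_ord -prodr_const; apply: ler_prod => l _.
rewrite sumr_ge0 //= /e -natr_sum ler_nat big_split /=.
have one c : (\sum_(n < M) (n == c :> nat) <= 1)%N.
  case: (ltnP c M) => hc; last first.
    by rewrite big1 // => n _; apply/eqP; rewrite eqb0; have := ltn_ord n; lia.
  rewrite (bigD1 (Ordinal hc)) //= eqxx big1 // => n hn.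
  by apply/eqP; rewrite eqb0.
by rewrite (leq_add (one _) (one _)).
Qed.
End Riesz.

(** * The quasimeasure on cubes as a Riesz product *)

Fixpoint nconstr (k : nat) : nat :=
  if k is k'.+1 then (nconstr k' + (2 * msq (nconstr k') == k'))%N else 0%N.

(** The last position read by constraint [i] is [2 * msq i], so [nconstr k] counts the constraints
    decided by the first [k] digits. Each new digit can decide only the first open constraint. *)
Lemma ltn_nconstr k i : (i < nconstr k)%N = (2 * msq i < k)%N.
Proof.
elim: k i => //= k IH i.
have le_msq j j' : (j <= j')%N -> (msq j <= msq j')%N.
  by rewrite leq_eqVlt => /orP[/eqP -> //|/msq_lt]; lia.
have := IH (nconstr k); rewrite ltnn => /esym/negbT; rewrite -leqNgt => hk.
case: (ltngtP i (nconstr k)) => [h|h|->].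
- by have := h; rewrite IH; lia.
- by have := msq_lt h; lia.
- by lia.
Qed.

Section Tau.
Variables (R : realType) (d : nat).
Implicit Types (g : Gd d) (n m : natv d).
Local Notation sg := (sg R).
Local Notation quad := (quad R).
Local Notation chi := (chi R).
Local Notation riesz := (riesz R).
Local Notation F := (Fset (R := R) (d := d)).

Lemma walsh_exp2 k (x : G) : walsh (2 ^ k) x = sg (x k).
Proof.
have E t : bit (2 ^ k) t = (t == k).
  have := @bitMD k 1 0 t; rewrite muln1 addn0 => ->; last by rewrite expn_gt0.
  case: (ltngtP t k) => h; first by rewrite /bit div0n.
    by rewrite (@bit_high 1 1) //; lia.
  by rewrite h subnn.
rewrite (@walsh_prod _ k.+1) ?ltn_exp2l // big_ord_recr /= big1 ?mul1r.
  by rewrite E eqxx andbT.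
by move=> t _; rewrite E ltn_eqF // andbF.
Qed.

(** The digits of [m], then those of [m'], appear reversed in [g]; this reversal turns the digitwise
    pairing of the Walsh function into the symmetric pairing of [quad]. *)
Lemma walsh_cube_quad k m m' g :
  (forall l, (m l < 2 ^ k)%N) -> (forall l, (m' l < 2 ^ k)%N) ->
  in_cube (2 * k) (fun l => 2 ^ k * m l + m' l)%N g ->
  walsh_cube k m m' = \prod_l quad k (g l).
Proof.
move=> hm hm' hg; apply: eq_bigr => l _.
rewrite (@walsh_prod _ k) //; apply: eq_bigr => t _; have ht := ltn_ord t.
rewrite /cube_pt ht !hg; [|lia|lia].
rewrite !bitMD // andbC.
have -> : (2 * k - 1 - (k - 1 - t) < k)%N = false by lia.
have -> : (2 * k - 1 - (k + t) < k)%N by lia.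
by congr (sg (bit _ _ && bit _ _)); lia.
Qed.

(** Both sides of the equation defining [Fs] are signs, so their equality says that their product is
    1. *)
Lemma FsP i g : Fs (R := R) i g <-> chi i g = 1.
Proof.
have -> : chi i g = \prod_l sg (g l (2 * msq i)%N) * \prod_l quad (msq i) (g l).
  by rewrite -big_split.
have E : walshd (fun _ => 2 ^ (2 * msq i))%N g = \prod_l sg (g l (2 * msq i)%N).
  by apply: eq_bigr => l _; rewrite walsh_exp2.
have sq : (\prod_l quad (msq i) (g l)) ^+ 2 = 1.
  rewrite -real_normK ?num_real // prod_norm1 ?expr1n // => l; exact: quad_norm.
split.
  move=> [m [m' [hm [hm' [hg]]]]]; rewrite (walsh_cube_quad hm hm' hg) E => ->.
  by rewrite -expr2.
move=> h.
pose k := msq i.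
pose m l := bitsum k (fun t => g l (k - 1 - t)%N).
pose m' l := bitsum k (fun t => g l (2 * k - 1 - t)%N).
have hm l : (m l < 2 ^ k)%N := bitsum_lt _ _.
have hm' l : (m' l < 2 ^ k)%N := bitsum_lt _ _.
have hg : in_cube (2 * k) (fun l => 2 ^ k * m l + m' l)%N g.
  move=> l t ht; rewrite bitMD // !bit_bitsum; case: ltnP => h1 /=.
    by congr (g l); lia.
  have -> : (2 * k - 1 - t - k < k)%N by lia.
  by congr (g l); lia.
exists m, m'; do 3!split => //.
rewrite (walsh_cube_quad hm hm' hg) E.
by rewrite -[LHS]mulr1 -[X in _ * X]sq expr2 mulrA h mul1r.
Qed.

Lemma in_cube_pt k m : in_cube k m (cube_pt k m).
Proof. by move=> l t ht; rewrite /cube_pt ht. Qed.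

Lemma in_cubeE k m g l t : in_cube k m g -> (t < k)%N -> g l t = cube_pt k m l t.
Proof. by move=> h ht; rewrite h // /cube_pt ht. Qed.

(* Outside the positions below [k], only the bits at the positions [2 * msq i]
   of one coordinate are set, and none of these positions lies in
   [[msq i', 2 * msq i')]; hence the quadratic parts of all the constraints still
   open only see the bits below [k], and each constraint is met separately. *)
Lemma meets_FsetP k m : (0 < d)%N ->
  meets k m F <-> (forall i, (2 * msq i < k)%N -> chi i (cube_pt k m) = 1).
Proof.
move=> d0; split.
  move=> [g [hF hg]] i hi; have /FsP <- := hF i.
  by apply: eq_chi => l t ht; apply/esym; apply: in_cubeE => //; lia.
move=> h; pose l0 : 'I_d := Ordinal d0.
(* [q i] tells whether the quadratic part of constraint [i] already equals 1; if not, the free bit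
   at [2 * msq i] corrects its sign. *)
pose q i : bool := `[< \prod_l quad (msq i) (cube_pt k m l) = 1 >].
pose g : Gd d := fun l t => if (t < k)%N then cube_pt k m l t else
  (l == l0) && `[< exists2 i, t = (2 * msq i)%N & ~~ q i >].
have gk l t : (t < k)%N -> g l t = cube_pt k m l t by rewrite /g => ->.
exists g; split; last by move=> l t ht; rewrite gk // in_cube_pt.
move=> i; apply/FsP; case: (ltnP (2 * msq i) k) => hi.
  rewrite -(h i hi); apply: eq_chi => l t ht; apply: gk; lia.
have hz l t : (msq i <= t < 2 * msq i)%N -> g l t = cube_pt k m l t.
  move=> ht; rewrite /g; case: ltnP => h1 //.
  rewrite /cube_pt ltnNge h1 /=; apply/negP => /andP[_ /asboolP[j ej _]].
  case: (ltngtP i j) => hij; [have := msq_lt hij; lia|have := msq_lt hij; lia|].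
  by move: ht; rewrite ej hij ltnn andbF.
have hq : forall l, quad (msq i) (g l) = quad (msq i) (cube_pt k m l).
  move=> l; apply: eq_bigr => t _; have ht := ltn_ord t.
  rewrite (hz _ (msq i + t)%N); last by lia.
  congr sg; case: (ltnP (msq i + t) k) => h1.
    by rewrite gk //; lia.
  by rewrite /cube_pt [(msq i + t < k)%N]ltnNge h1 !andbF.
have -> : chi i g = \prod_l sg (g l (2 * msq i)%N) * \prod_l quad (msq i) (g l).
  by rewrite -big_split.
rewrite (eq_bigr _ (fun l _ => hq l)).
have gi l : g l (2 * msq i)%N = (l == l0) && ~~ q i.
  rewrite /g ltnNge hi /=; congr andb; apply/asboolP/idP => [[j ej]|]; last by exists i.
  case: (ltngtP i j) => hij; [have := msq_lt hij; lia|have := msq_lt hij; lia|by subst j].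
rewrite (bigD1 l0) //= big1 ?mulr1; last by move=> l hl; rewrite gi (negbTE hl).
rewrite gi eqxx /=.
have : `|\prod_l quad (msq i) (cube_pt k m l)| = 1.
  by apply: prod_norm1 => l; exact: quad_norm.
rewrite /q; case: asboolP => [-> _|hne]; first by rewrite mulr1.
case: (ler0P (\prod_l _)) => _ hh; last by [].
by rewrite /sg /= mulN1r.
Qed.

Lemma sum_prod_sg : (0 < d)%N ->
  \sum_(s : {ffun 'I_d -> bool}) \prod_l sg (s l) = 0.
Proof.
move=> d0; rewrite -(bigA_distr_bigA (fun (l : 'I_d) b => sg b)).
rewrite (bigD1 (Ordinal d0)) //= big_bool /sg /=.
by rewrite expr1 expr0 addNr mul0r.
Qed.
(** Passing to rank [k.+1] decides either no new constraint, and all [2 ^ d] children of a cube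
    meeting [F] meet it, or exactly one, and half of them do. The density is accordingly multiplied
    by 1 or by [1 + chi]. *)
Lemma tauF_riesz k m : (0 < d)%N ->
  tauF k m = riesz (nconstr k) (cube_pt k m) / 2 ^+ (k * d).
Proof.
move=> d0; elim: k m => [|k IH] m; first by rewrite /tauF /= /riesz big_ord0 mul0n divr1.
pose m2 : natv d := fun l => (m l %/ 2)%N.
pose ch (s : {ffun 'I_d -> bool}) : natv d := fun l => (2 * m2 l + s l)%N.
have div2 s l : (ch s l %/ 2)%N = m2 l.
  by rewrite /ch mulnC divnMDl // divn_small ?addn0 //; case: (s l).
have ptS (n : natv d) l t : (t < k)%N ->
    cube_pt k.+1 n l t = cube_pt k (fun l => n l %/ 2)%N l t.
  move=> ht; rewrite /cube_pt ht (ltn_trans ht (ltnSn k)) bit_half.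
  by congr bit; lia.
have ptc s l t : (t < k)%N -> cube_pt k.+1 (ch s) l t = cube_pt k m2 l t.
  by move=> ht; rewrite ptS // /cube_pt div2.
have ptck s l : cube_pt k.+1 (ch s) l k = s l.
  rewrite /cube_pt ltnSn (_ : (k.+1 - 1 - k)%N = 0%N); last by lia.
  by rewrite /bit divn1 oddD mul2n odd_double /= oddb.
have chiS i n : (2 * msq i < k)%N -> (forall l, n l %/ 2 = m2 l)%N ->
    chi i (cube_pt k.+1 n) = chi i (cube_pt k m2).
  move=> hi hn; apply: eq_chi => l t ht; rewrite ptS; last by lia.
  by rewrite /cube_pt hn.
rewrite /tauF /= -/(tauF _ _) IH.
have rz : riesz (nconstr k) (cube_pt k.+1 m) = riesz (nconstr k) (cube_pt k m2).
  apply: eq_riesz => l t i; rewrite ltn_nconstr => hi ht; rewrite ptS //; lia.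
case: asboolP => [/(meets_FsetP _ _ d0) hm|/(meets_FsetP _ _ d0) hm]; last first.
  rewrite -/(nconstr k.+1).
  have [i hi hc] : exists2 i, (2 * msq i < k.+1)%N & chi i (cube_pt k.+1 m) <> 1.
    apply: contrapT => hn; apply: hm => i hi; apply: contrapT => hc.
    by apply: hn; exists i.
  rewrite (@riesz_eq0 _ _ _ _ i) ?mul0r ?ltn_nconstr //.
  by case: (chi_cases R i (cube_pt k.+1 m)).
have hm2 i : (2 * msq i < k)%N -> chi i (cube_pt k m2) = 1.
  by move=> hi; rewrite -(chiS i m) // hm // ltnW.
have exp0 p : (2 ^+ p : R) != 0 by rewrite expf_neq0 // pnatr_eq0.
rewrite mulSn exprD.
case: eqP => hL; rewrite ?addn1 ?addn0.
  have {}hL : (2 * msq (nconstr k) = k)%N := hL.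
  have -> : (\sum_(s : {ffun 'I_d -> bool})
      `[< meets k.+1 (fun l => 2 * (m l %/ 2) + s l)%N F >])%:R
      = 2 ^+ d / 2 :> R.
    rewrite natr_sum.
    (* The indicator that a child meets [F] is [(1 + chi) / 2], and the signs sum to 0 over the
       children. *)
    transitivity (\sum_(s : {ffun 'I_d -> bool}) ((1 + (\prod_l sg (s l)) *
        \prod_l quad (msq (nconstr k)) (cube_pt k m2 l)) / 2)).
      apply: eq_bigr => s _.
      have E : chi (nconstr k) (cube_pt k.+1 (ch s)) = (\prod_l sg (s l)) *
         \prod_l quad (msq (nconstr k)) (cube_pt k m2 l).
        rewrite -big_split; apply: eq_bigr => l _; rewrite hL ptck; congr (_ * _).
        by apply: eq_quad => t ht; apply: ptc; lia.
      rewrite -E; case: asboolP => [/(meets_FsetP _ _ d0) hc|/(meets_FsetP _ _ d0) hn].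
        by rewrite hc ?hL //=; field.
      case: (chi_cases R (nconstr k) (cube_pt k.+1 (ch s))) => hc; last first.
        by rewrite hc subrr mul0r.
      case: hn => i hi; case: (ltngtP i (nconstr k)) => hi2.
      - have hi3 : (2 * msq i < k)%N by rewrite -ltn_nconstr.
        by rewrite (chiS _ _ hi3 (div2 s)) hm2.
      - by have := msq_lt hi2; lia.
      - by rewrite hi2.
    rewrite -mulr_suml big_split /= -mulr_suml (sum_prod_sg d0) mul0r addr0.
    by rewrite sumr_const card_ffun card_bool card_ord -natrX.
  rewrite rieszS rz hm ?hL //.
  by field; rewrite !exp0.
have -> : (\sum_(s : {ffun 'I_d -> bool})
      `[< meets k.+1 (fun l => 2 * (m l %/ 2) + s l)%N F >])%:R
      = 2 ^+ d :> R.
  rewrite (eq_bigr (fun=> 1%N)).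
    by rewrite sum1_card card_ffun card_bool card_ord natrX.
  move=> s _; apply/eqP; rewrite eqb1; apply/asboolP/(meets_FsetP _ _ d0) => i.
  rewrite ltnS leq_eqVlt => /orP[/eqP hi|hi]; last first.
    by rewrite (chiS _ _ hi (div2 s)) hm2.
  have : (i < nconstr k.+1)%N by rewrite ltn_nconstr hi.
  by move=> /=; move/eqP/negbTE: hL => ->; rewrite addn0 ltn_nconstr hi ltnn.
by rewrite rz; field; rewrite !exp0.
Qed.
End Tau.

(** * Fourier-Walsh coefficients and rectangular partial sums off [F] *)

Section Coef.
Variables (R : realType) (d : nat).
Implicit Types (g : Gd d) (n m N : natv d).
Local Notation chi := (chi R).
Local Notation riesz := (riesz R).
Local Notation block_coef := (block_coef R).
Local Notation block_sum := (block_sum R).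

Lemma walsh0 (x : G) : walsh 0 x = 1 :> R.
Proof. by rewrite /walsh big_ord0 expr0. Qed.

Lemma block_coef_eq0 i n l : (n l < 2 ^ (2 * msq i))%N -> block_coef i n = 0.
Proof.
move=> h; rewrite /block_coef (_ : [forall l, _] = false) ?mul0r //.
by apply/negbTE/forallPn; exists l; rewrite divn_small.
Qed.

Lemma block_coef_neq0 i n l : block_coef i n != 0 ->
  (2 ^ (2 * msq i) <= n l < 2 * 2 ^ (2 * msq i))%N.
Proof.
rewrite /block_coef.
have [/forallP h _|_] := boolP [forall l, n l %/ 2 ^ (2 * msq i) == 1]%N; last first.
  by rewrite !mul0r eqxx.
have /eqP := h l => h1; rewrite -ltn_divLR ?expn_gt0 // h1 andbT.
by rewrite -[X in (X <= _)%N]mul1n -leq_divRL ?expn_gt0 // h1.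
Qed.

Definition series_coef L n : R := [forall l, n l == 0%N]%:R + \sum_(i < L) block_coef i n.

(** In each block all coordinates lie in the same dyadic range, hence within a factor 2 of each
    other. This makes the inner sums of iterated summation finite. *)
Lemma series_coef_neq0 L n l l' : series_coef L n != 0 -> (n l <= 2 * n l')%N.
Proof.
rewrite /series_coef; have [/forallP h _|_] := boolP [forall l, n l == 0%N].
  by rewrite (eqP (h l)).
rewrite add0r => hs.
have [i hi] : exists i : 'I_L, block_coef i n != 0.
  apply/existsP; apply: contra_neqT hs => /existsPn h; apply: big1 => i _.
  by apply/eqP; have := h i; rewrite negbK.
by have := block_coef_neq0 l hi; have := block_coef_neq0 l' hi; lia.
Qed.

Lemma exp2_archi (c e : R) : 0 <= c -> 0 < e ->
  exists I, forall i, (I <= i)%N -> c / 2 ^+ i < e.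
Proof.
move=> c0 he; exists (Num.bound (c / e)) => i hi.
rewrite ltr_pdivrMr ?exprn_gt0 // mulrC -ltr_pdivrMr //.
apply: lt_le_trans (archi_boundP _) _; first by rewrite divr_ge0 // ltW.
by rewrite -natrX ler_nat; apply: leq_trans hi (ltnW (ltn_expl _ _)).
Qed.

Hypothesis d0 : (0 < d)%N.

Lemma sum_delta0 M N g : (forall l, 0 < N l <= M)%N ->
  \sum_(n : {ffun 'I_d -> 'I_M} | [forall l, (n l < N l)%N])
    [forall l, n l == 0%N :> nat]%:R * walshd (fun l => nat_of_ord (n l)) g = 1 :> R.
Proof.
move=> hN.
have M0 : (0 < M)%N by case/andP: (hN (Ordinal d0)) => /leq_trans h /h.
pose z : {ffun 'I_d -> 'I_M} := [ffun=> Ordinal M0].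
rewrite (bigD1 z) /=; last by apply/forallP => l; rewrite ffunE; case/andP: (hN l).
rewrite (_ : [forall l, _]); last by apply/forallP => l; rewrite ffunE.
rewrite mul1r /walshd big1; last by move=> l _; rewrite ffunE /= walsh0.
rewrite big1 ?addr0 // => n /andP[_ hn].
rewrite (_ : [forall l, _] = false) ?mul0r //; apply: contraNF hn => /forallP h.
by apply/eqP/ffunP => l; apply: val_inj; rewrite ffunE /=; apply/eqP.
Qed.

Lemma series_coef_sum L M N g : (forall l, 0 < N l <= M)%N ->
  \sum_(n : {ffun 'I_d -> 'I_M} | [forall l, (n l < N l)%N])
    series_coef L (fun l => nat_of_ord (n l)) * walshd (fun l => nat_of_ord (n l)) g =
  1 + \sum_(i < L) block_sum i M N g.
Proof.
move=> hN; rewrite -(sum_delta0 g hN) exchange_big -big_split /=.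
by apply: eq_bigr => n _; rewrite mulrDl mulr_suml.
Qed.

(** The blocks before [nconstr k] have all their frequencies below [2 ^ k], so the cube of side
    [2 ^ k] contains them completely. *)
Lemma riesz_expand k g :
  riesz (nconstr k) g = \sum_(n : {ffun 'I_d -> 'I_(2 ^ k)})
    series_coef (nconstr k) (fun l => nat_of_ord (n l)) * walshd (fun l => nat_of_ord (n l)) g.
Proof.
pose N : natv d := fun=> (2 ^ k)%N.
transitivity (\sum_(n : {ffun 'I_d -> 'I_(2 ^ k)} | [forall l, (n l < N l)%N])
    series_coef (nconstr k) (fun l => nat_of_ord (n l)) *
    walshd (fun l => nat_of_ord (n l)) g); last first.
  by apply: eq_bigl => n; apply/forallP => l; apply: ltn_ord.
rewrite series_coef_sum; last by move=> l; rewrite expn_gt0 leqnn.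
rewrite riesz_sum; congr (_ + _); apply: eq_bigr => i _.
rewrite block_sum_full // => l; rewrite leq_exp2l //.
by rewrite -ltn_nconstr.
Qed.

Lemma walshd_orth k n n' : (forall l, n l < 2 ^ k)%N -> (forall l, n' l < 2 ^ k)%N ->
  \sum_(m : {ffun 'I_d -> 'I_(2 ^ k)})
    walshd n (cube_pt k (fun l => nat_of_ord (m l))) *
    walshd n' (cube_pt k (fun l => nat_of_ord (m l))) =
  2 ^+ (k * d) * [forall l, n l == n' l]%:R :> R.
Proof.
move=> hn hn'.
pose T l (m : 'I_(2 ^ k)) : R :=
  walsh (n l) (fun t => if (t < k)%N then bit m (k - 1 - t) else false) *
  walsh (n' l) (fun t => if (t < k)%N then bit m (k - 1 - t) else false).
transitivity (\sum_(m : {ffun 'I_d -> 'I_(2 ^ k)}) \prod_l T l (m l)).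
  by apply: eq_bigr => m _; rewrite /walshd -big_split.
rewrite -bigA_distr_bigA (eq_bigr (fun l => 2 ^+ k * (n l == n' l)%:R)); last first.
  by move=> l _; rewrite walsh_orth.
rewrite big_split /= prodr_const card_ord -exprM; congr (_ * _).
rewrite -natr_prod; congr _%:R.
have [/forallP h|/forallPn[l hl]] := boolP [forall l, n l == n' l].
  by rewrite big1 // => l _; rewrite h.
by rewrite (bigD1 l) //= (negbTE hl).
Qed.

(** The Walsh expansion of the density at rank [k] is inserted in the defining sum, and
    orthogonality extracts the coefficient of index [n]. *)
Lemma quasi_coef_series_coef n L : (forall l, n l <= L)%N ->
  quasi_coef (tauF (R := R) (d := d)) n = series_coef L n.
Proof.
move=> hL; rewrite /quasi_coef; set k := (\max_(l < d) n l)%N.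
have hk l : (n l < 2 ^ k)%N by apply: leq_ltn_trans (ltn_expl k (ltnSn 1)); exact: leq_bigmax.
have kL : (k <= L)%N by apply/bigmax_leqP => l _.
transitivity (series_coef (nconstr k) n).
  transitivity (\sum_(n' : {ffun 'I_d -> 'I_(2 ^ k)})
     series_coef (nconstr k) (fun l => nat_of_ord (n' l)) * [forall l, n l == n' l :> nat]%:R).
    transitivity (\sum_(m : {ffun 'I_d -> 'I_(2 ^ k)}) \sum_(n' : {ffun 'I_d -> 'I_(2 ^ k)})
       (series_coef (nconstr k) (fun l => nat_of_ord (n' l)) / 2 ^+ (k * d) *
       (walshd n (cube_pt k (fun l => nat_of_ord (m l))) *
        walshd (fun l => nat_of_ord (n' l)) (cube_pt k (fun l => nat_of_ord (m l)))))).
      apply: eq_bigr => m _; rewrite /walsh_cube tauF_riesz // riesz_expand mulr_suml mulr_sumr.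
      by apply: eq_bigr => n' _; ring.
    rewrite exchange_big; apply: eq_bigr => n' _; rewrite -mulr_sumr walshd_orth //.
    by rewrite mulrA divfK // expf_neq0 // pnatr_eq0.
  pose n0 : {ffun 'I_d -> 'I_(2 ^ k)} := [ffun l => Ordinal (hk l)].
  rewrite (bigD1 n0) //= big1 ?addr0.
    rewrite (_ : [forall l, _]) ?mulr1; last by apply/forallP => l; rewrite ffunE.
    by congr series_coef; apply/funext => l; rewrite ffunE.
  move=> n' hn'; rewrite (_ : [forall l, _] = false) ?mulr0 //.
  apply: contraNF hn' => /forallP h; apply/eqP/ffunP => l; apply: val_inj.
  by rewrite ffunE /=; apply/esym/eqP.
(* Blocks from [nconstr k] on have all coordinates at least [2 ^ k], beyond [n]. *)
congr (_ + _).
have hnc : (nconstr k <= L)%N.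
  apply: leq_trans kL; rewrite leqNgt ltn_nconstr; have := leq_msq k; lia.
rewrite -!(big_mkord xpredT (fun i => block_coef i n))
  [RHS](big_cat_nat (leq0n (nconstr k)) hnc) /=.
rewrite [X in _ = _ + X]big1_seq ?addr0 // => i; rewrite mem_index_iota => /andP[_ /andP[hi _]].
apply: (block_coef_eq0 (l := Ordinal d0)); apply: leq_trans (hk _) _.
by rewrite leq_exp2l // leqNgt -ltn_nconstr -leqNgt.
Qed.

Lemma series_coef_sum_cvg g j (e : R) : chi j g = -1 -> 0 < e ->
  exists K, forall M N, (forall l, K <= N l <= M)%N ->
    `|\sum_(n : {ffun 'I_d -> 'I_M} | [forall l, (n l < N l)%N])
      series_coef M (fun l => nat_of_ord (n l)) *
      walshd (fun l => nat_of_ord (n l)) g| < e.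
Proof.
move=> hj he.
have [I0 hI0] : exists I, forall i, (I <= i)%N ->
    2 ^+ (2 * msq j).+1 * 2 ^+ d / 2 ^+ i < e.
  by apply: exp2_archi; rewrite ?mulr_ge0 ?exprn_ge0.
pose I := maxn I0 j.+1.
exists (2 ^ (2 * msq I)).+1 => M N hN.
have N0 l : (0 < N l <= M)%N.
  by case/andP: (hN l) => h ->; rewrite (leq_trans _ h).
rewrite series_coef_sum //.
(* [P i] says that the rectangle enters block [i] in every coordinate; the maximal such [i] is the
   only block that can be cut. The choice of [K] makes [P I] true. *)
pose P i := [forall l, 2 ^ (2 * msq i) < N l]%N.
pose l0 : 'I_d := Ordinal d0.
have PI : exists i, P i by exists I; apply/forallP => l; case/andP: (hN l).
have Plt i : P i -> (i < N l0)%N.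
  move=> /forallP/(_ l0) h; apply: leq_ltn_trans h.
  apply: leq_trans (ltnW (ltn_expl i (ltnSn 1))) _; rewrite leq_exp2l //.
  by have := leq_msq i; lia.
have Pb i : P i -> (i <= N l0)%N by move/Plt/ltnW.
case: (ex_maxnP PI Pb) => i Pi Pmax.
have iI : (I <= i)%N by apply: Pmax; apply/forallP => l; case/andP: (hN l).
have iM : (i < M)%N by case/andP: (hN l0) => _; apply: leq_trans (Plt _ Pi).
have [l1 hl1] : exists l, (N l <= 2 ^ (2 * msq i.+1))%N.
  have : ~~ P i.+1 by apply/negP => /Pmax; rewrite ltnn.
  by case/forallPn => l; rewrite -leqNgt; exists l.
(* Blocks before [i] lie inside the rectangle and sum up to [riesz i g]; blocks after [i] miss it in
   coordinate [l1]. *)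
have -> : 1 + \sum_(i < M) block_sum i M N g = riesz i g + block_sum i M N g.
  rewrite riesz_sum -addrA; congr (_ + _).
  rewrite -!(big_mkord xpredT (fun i => block_sum i M N g)).
  rewrite (big_cat_nat (leq0n i) (ltnW iM)) /= big_mkord; congr (_ + _).
    apply: eq_bigr => i' _; rewrite block_sum_full // => l; first by case/andP: (hN l).
    have /forallP/(_ l) h := Pi; apply: ltnW; apply: leq_ltn_trans h.
    rewrite leq_exp2l //; have := msq_lt (ltn_ord i'); lia.
  rewrite big_ltn // big1_seq ?addr0 // => i'; rewrite mem_index_iota => /andP[_ /andP[hi' _]].
  rewrite /block_sum big1 // => n /forallP/(_ l1) hn.
  rewrite (block_coef_eq0 (l := l1)) ?mul0r //; apply: leq_trans hn _; apply: leq_trans hl1 _.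
  rewrite leq_exp2l //; move: hi'; rewrite leq_eqVlt => /orP[/eqP -> //|/msq_lt]; lia.
have ji : (j < i)%N by move: iI; rewrite /I; lia.
rewrite (riesz_eq0 ji hj) add0r.
apply: le_lt_trans (block_sum_norm_le _ ji hj) _; first by move=> l; case/andP: (hN l).
apply: le_lt_trans (hI0 i _); last by move: iI; rewrite /I; lia.
set c := 2 ^+ (2 * msq j).+1.
have -> : 2 ^+ i * (c / 2 ^+ msq i) * 2 ^+ d = (c * 2 ^+ d) * (2 ^+ i / 2 ^+ msq i) by ring.
rewrite ler_wpM2l ?mulr_ge0 ?exprn_ge0 //.
rewrite ler_pdivrMr ?exprn_gt0 // -ler_pdivrMl ?invr_gt0 ?exprn_gt0 // invrK -exprD.
by rewrite ler_weXn2l ?ler1n // addnn -mul2n leq_msq.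
Qed.
End Coef.

(** * Iterated finite sums and iterated series *)

Section IteratedSums.
Variables (V : nmodType) (d : nat).
Implicit Types (N n : natv d) (f : natv d -> V) (js : seq 'I_d).

Fixpoint isum N js f n : V :=
  if js is j :: js' then \sum_(x < N j) isum N js' f (setc n j x) else f n.

Definition agree_off js n n' := forall l, l \notin js -> n' l = n l.

Lemma agree_off_setc j js n n' x : j \notin js ->
  agree_off js (setc n j x) n' -> agree_off (j :: js) n n' /\ n' j = x.
Proof.
move=> hj h; split; last by rewrite h // /setc eqxx.
by move=> l; rewrite inE => /norP[lj ljs]; rewrite h // /setc (negbTE lj).
Qed.

(** Fubini for finite sums, by splitting a rectangular sum according to the value of its outermost
    coordinate. *)
Lemma isum_ffun M N js f n0 : uniq js ->
  (forall l, n0 l < M)%N -> (forall l, N l <= M)%N ->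
  isum N js f n0 = \sum_(n : {ffun 'I_d -> 'I_M} |
      [forall l, if l \in js then (n l < N l)%N else n l == n0 l :> nat])
    f (fun l => nat_of_ord (n l)).
Proof.
move=> + + NM; elim: js n0 => [|j js IH] n0 /=.
  move=> _ hn0; pose z : {ffun 'I_d -> 'I_M} := [ffun l => Ordinal (hn0 l)].
  rewrite (big_pred1 z); first by congr f; apply/funext => l; rewrite ffunE.
  move=> n /=; apply/forallP/eqP => [h|-> l]; last by rewrite ffunE.
  by apply/ffunP => l; apply: val_inj; rewrite ffunE; exact/eqP/h.
case/andP=> hj ujs hn0.
rewrite (big_ord_widen _ (fun x => isum N js f (setc n0 j x)) (NM j)).
rewrite [RHS](partition_big (fun n : {ffun 'I_d -> 'I_M} => n j)
  (fun x => (x < N j)%N)) /=; last first.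
  by move=> n /forallP/(_ j); rewrite mem_head.
apply: eq_bigr => x hx; rewrite IH //; last first.
  by move=> l; rewrite /setc; case: eqP.
apply: eq_bigl => n; apply/forallP/andP => [h|[/forallP h /eqP hnx] l].
  have hnx : n j = x.
    by have := h j; rewrite (negbTE hj) /setc eqxx => /eqP/val_inj.
  split; last by rewrite hnx.
  apply/forallP => l; have := h l; rewrite inE /setc.
  by case: (eqVneq l j) => [->|]; rewrite ?hnx.
have := h l; rewrite inE /setc; case: (eqVneq l j) => [->|] //=.
by rewrite (negbTE hj) hnx eqxx.
Qed.

Lemma isum_eq0 N js f n : uniq js ->
  (forall n', agree_off js n n' -> f n' = 0) -> isum N js f n = 0.
Proof.
elim: js n => [|j js IH] n /=; first by move=> _; apply.
case/andP=> hj ujs h; apply: big1 => x _; apply: IH => // n' hn'.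
by apply: h; case: (agree_off_setc hj hn').
Qed.

Definition supp_below B js f n :=
  forall n', agree_off js n n' -> f n' <> 0 -> forall l, l \in js -> (n' l < B)%N.

Lemma supp_below_setc B j js f n x : j \notin js ->
  supp_below B (j :: js) f n -> supp_below B js f (setc n j x).
Proof.
move=> hj h n' hn' hf l hl; have [h1 _] := agree_off_setc hj hn'.
by apply: (h n' h1 hf l); rewrite inE hl orbT.
Qed.

Lemma isum_setc_eq0 B N j js f n x : uniq (j :: js) ->
  supp_below B (j :: js) f n -> (B <= x)%N -> isum N js f (setc n j x) = 0.
Proof.
move=> /= /andP[hj ujs] h hx; apply: isum_eq0 => // n' hn'.
have [h1 h2] := agree_off_setc hj hn'.
by apply: contrapT => hf; have := h n' h1 hf j (mem_head _ _); rewrite h2 ltnNge hx.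
Qed.

Lemma isum_widen B N js f n : uniq js -> supp_below B js f n ->
  (forall l, l \in js -> B <= N l)%N ->
  isum N js f n = isum (fun=> B) js f n.
Proof.
elim: js n => [//|j js IH] n ujs h hN /=.
have hj := hN j (mem_head _ _); case/andP: (ujs) => njs ujs'.
rewrite -!(big_mkord xpredT (fun x => isum _ js f (setc n j x))).
rewrite (big_cat_nat (leq0n B) hj) /= [X in _ + X]big1_seq ?addr0; last first.
  move=> x; rewrite mem_index_iota => /andP[_ /andP[hx _]].
  exact: isum_setc_eq0 ujs h hx.
apply: eq_bigr => x _; apply: IH => //; first exact: supp_below_setc.
by move=> l hl; apply: hN; rewrite inE hl orbT.
Qed.

End IteratedSums.

Section IterCvg.
Variables (R : realType) (d : nat).
Implicit Types (N n : natv d) (f : natv d -> R[i]) (js : seq 'I_d).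

(** With support below [B], every series involved has partial sums constant from [B] on, so the
    iterated limit is a finite sum. *)
Lemma iter_sum_isum B js f n : uniq js -> supp_below B js f n ->
  iter_sum js f n (isum (fun=> B) js f n).
Proof.
elim: js n => [//|j js IH] n ujs h /=; case/andP: (ujs) => njs ujs'.
exists (fun x => isum (fun=> B) js f (setc n j x)); split.
  by move=> x; apply: IH => //; exact: supp_below_setc.
move=> e he; exists B => N BN.
rewrite -!(big_mkord xpredT (fun x => isum _ js f (setc n j x))).
rewrite (big_cat_nat (leq0n B) BN) /= [X in _ + X - _]big1_seq.
  by rewrite addr0 subrr normr0 ltcR.
move=> x; rewrite mem_index_iota => /andP[_ /andP[hx _]].
exact: isum_setc_eq0 ujs h hx.
Qed.

End IterCvg.

(** * The three types of convergence *)

Section Main.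
Variables (R : realType) (d : nat).
Hypothesis hd : (2 <= d)%N.
Implicit Types (N n : natv d) (g : Gd d).
Local Notation F := (Fset (R := R) (d := d)).
Local Notation a := (tauF_coef (R := R) (d := d)).

Let d0 : (0 < d)%N. Proof. exact: ltnW hd. Qed.

Lemma walshd_complex n g : walshd n g = (walshd n g : R)%:C.
Proof.
rewrite /walshd rmorph_prod; apply: eq_bigr => l _.
by rewrite /walsh rmorphXn rmorphN1.
Qed.

Lemma normcR (x : R) : `|x%:C| = `|x|%:C.
Proof. by rewrite normc_def /= expr0n /= addr0 sqrtr_sqr. Qed.

Lemma psum_series_coef N g : psum a N g =
  (\sum_(n : {ffun 'I_d -> 'I_(\max_(l < d) N l)} | [forall l, (n l < N l)%N])
    series_coef R (\max_(l < d) N l) (fun l => nat_of_ord (n l)) *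
    walshd (fun l => nat_of_ord (n l)) g)%:C.
Proof.
rewrite /psum rmorph_sum; apply: eq_bigr => n _; rewrite walshd_complex.
rewrite rmorphM; congr (_ * _).
rewrite /tauF_coef (@quasi_coef_series_coef _ _ d0 _ (\max_(l < d) N l)) //.
by move=> l; apply: ltnW.
Qed.

Lemma tauF_cvg_rect g : ~ F g -> cvg_rect a g 0.
Proof.
move=> hg e he.
have [j hj] : exists j, chi R j g = -1.
  apply: contrapT => hn; apply: hg => i; apply/FsP.
  by case: (chi_cases R i g) => // h; case: hn; exists i.
have [K hK] := series_coef_sum_cvg d0 hj he.
exists K => N hN; rewrite subr0 psum_series_coef normcR ltcR; apply: hK => l.
by case: (hN l) => _ ->; exact: leq_bigmax.
Qed.

Lemma tauF_cvg_cube g : ~ F g -> cvg_cube a g 0.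
Proof.
move=> hg e he; have [K hK] := tauF_cvg_rect hg he.
exists (maxn K 1) => N; rewrite geq_max => /andP[KN N0].
by apply: hK => l; split.
Qed.

Lemma tauF_coef_le n l l' : a n <> 0 -> (n l <= 2 * n l')%N.
Proof.
move=> h; apply: (@series_coef_neq0 R _ (\max_(l < d) n l) n); apply/eqP => h0; apply: h.
rewrite /tauF_coef (@quasi_coef_series_coef _ _ d0 _ (\max_(l < d) n l)) ?h0 //.
by move=> k; exact: leq_bigmax.
Qed.

(** Fixing the outermost frequency at [x] confines the others to at most [2 * x]. The outer partial
    sums are therefore rectangular partial sums, with the other sides as long as desired. *)
Lemma tauF_cvg_rep js g : perm_eq js (enum 'I_d) -> ~ F g -> cvg_rep js a g 0.
Proof.
move=> hjs hg.
have ujs : uniq js by rewrite (perm_uniq hjs) enum_uniq.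
have mjs l : l \in js by rewrite (perm_mem hjs) mem_enum.
case: js ujs mjs {hjs} => [|j js] ujs mjs; first by have := mjs (Ordinal d0).
rewrite /cvg_rep /=; set f := fun n => _; set z : natv d := fun=> 0%N.
have /andP[njs ujs'] := ujs.
have supp x B : (2 * x < B)%N -> supp_below B js f (setc z j x).
  move=> hB n' hn' hf l hl; have [_ hx] := agree_off_setc njs hn'.
  apply: leq_ltn_trans hB; rewrite -hx; apply: tauF_coef_le => h0.
  by apply: hf; rewrite /f h0 mul0r.
exists (fun x => isum (fun=> (2 * x).+1) js f (setc z j x)); split.
  by move=> x; apply: iter_sum_isum => //; exact: supp.
move=> e he; have [K hK] := tauF_cvg_rect hg he.
exists (maxn K 1) => X; rewrite geq_max => /andP[KX X0].
(* The inner sides exceed every support met for [x < X] and reach the threshold [K]. *)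
pose N : natv d := fun l => if l == j then X else maxn K (2 * X).+1.
have -> : \sum_(x < X) isum (fun=> (2 * x).+1) js f (setc z j x) = psum a N g.
  transitivity (isum N (j :: js) f z).
    have NjX : N j = X by rewrite /N eqxx.
    rewrite /= NjX; apply: eq_bigr => x _; apply/esym/isum_widen => //.
      exact: supp.
    move=> l hl; rewrite /N; case: eqP => [lj|_]; first by rewrite lj (negbTE njs) in hl.
    by have := ltn_ord x; lia.
  rewrite (@isum_ffun _ _ (\max_(l < d) N l)) //; last first.
  - by move=> l; exact: leq_bigmax.
  - move=> l; apply: leq_trans (leq_bigmax j); rewrite /N eqxx //.
  rewrite /psum; apply: eq_bigl => n; apply: eq_forallb => l.
  by rewrite mjs.
by apply: hK => l; rewrite /N; case: eqP => _; split => //; lia.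
Qed.

Lemma tauF_coef_neq0 : exists n, a n != 0.
Proof.
(* The coefficient of index 0 is the total mass 1. *)
exists (fun=> 0%N); rewrite /tauF_coef (@quasi_coef_series_coef _ _ d0 _ 0) //.
rewrite /series_coef big_ord0 addr0 (_ : [forall l, _]); first exact: oner_neq0.
by apply/forallP.
Qed.
End Main.

Theorem theorem1 (R : realType) (d : nat) (hd : (2 <= d)%N) :
  let F := Fset (R := R) (d := d) in
  let a := tauF_coef (R := R) (d := d) in
  [/\ Mset (cvg_rect (R := R) (d := d)) F,
      Mset (cvg_cube (R := R) (d := d)) F &
      (forall js : seq 'I_d, perm_eq js (enum 'I_d) ->
         Mset (cvg_rep (R := R) js) F)] /\
  [/\ null_series (cvg_rect (R := R) (d := d)) F a,
      null_series (cvg_cube (R := R) (d := d)) F a &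
      (forall js : seq 'I_d, perm_eq js (enum 'I_d) ->
         null_series (cvg_rep (R := R) js) F a)].
Proof.
move=> F a.
have nz := tauF_coef_neq0 R hd.
have rect : null_series (cvg_rect (R := R) (d := d)) F a.
  by split=> // g; exact: tauF_cvg_rect.
have cube : null_series (cvg_cube (R := R) (d := d)) F a.
  by split=> // g; exact: tauF_cvg_cube.
have rep js : perm_eq js (enum 'I_d) -> null_series (cvg_rep (R := R) js) F a.
  by move=> hjs; split=> // g; exact: tauF_cvg_rep.
split; split; [by exists a|by exists a| |exact: rect|exact: cube|exact: rep].
by move=> js hjs; exists a; exact: rep.
Qed.
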